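(* For each integer $n\ge 1$, $$\sup_{R}\frac{R'(0)}{\|R\|}\ge 9^{n-1},$$ where the supremum is taken over the set of all rational functions $R\in Q_{2n-1}$ that are odd and (strictly) increasing on $[-1,1]$.
   Context: For a nonnegative integer $m$, $P_m$ denotes the space of all real algebraic polynomials of degree at most $m$, and $Q_m$ denotes the set of all rational functions $r=\frac pq$ with $p,q\in P_m$ ($q\not\equiv 0$) that are continuous on $[-1,1]$. The norm $\|\cdot\|=\|\cdot\|_{C[-1,1]}$ is the uniform norm on $[-1,1]$, i.e. $\|R\|=\max_{x\in[-1,1]}|R(x)|$. The supremum is understood in the extended real numbers. *)

(* Defs.v *)
From HB Require Import structures.
From mathcomp Require Import all_boot all_order all_algebra.
From mathcomp Require Import all_classical all_reals all_analysis.

Set Implicit Arguments.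
Unset Strict Implicit.
Unset Printing Implicit Defensive.

Import Order.TTheory GRing.Theory Num.Theory.
Import numFieldNormedType.Exports.

Local Open Scope classical_set_scope.
Local Open Scope ring_scope.

Definition polys_upto (K : realType) (m : nat) : set {poly K} :=
  [set p | (size p <= m.+1)%N].

(* A rational function is given by its values on [-1, 1].  The zeros of q are
   exempted from the equation because p and q may have common factors; there
   the value of r is the one forced by continuity.  The values of r outside
   [-1, 1] are irrelevant. *)
Definition rational_upto (K : realType) (m : nat) : set (K -> K) :=
  [set r : K -> K | {within `[-1 : K, 1], continuous r} /\
    exists p q : {poly K},
      [/\ polys_upto m p, polys_upto m q, q != 0 &
        forall x, x \in `[-1 : K, 1] -> q.[x] != 0 -> r x = p.[x] / q.[x]]].

(* For r continuous on [-1, 1] this supremum is finite and attained. *)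
Definition uniform_norm (K : realType) (r : K -> K) : K :=
  sup [set `|r x| | x in `[-1 : K, 1]].

Definition odd_on (K : realType) (r : K -> K) : Prop :=
  forall x, x \in `[-1 : K, 1] -> r (- x) = - r x.

Definition increasing_on (K : realType) (r : K -> K) : Prop :=
  {in `[-1 : K, 1] &, {homo r : x y / x < y}}.

(* Main.v *)
Require Import Defs.
From HB Require Import structures.
From mathcomp Require Import all_boot all_order all_algebra.
From mathcomp Require Import all_classical all_reals all_analysis.
From mathcomp Require Import ring lra.


(** For 1 < s < 3 and positive b_1, ..., b_k consider
      R x = x * prod_i (x^2 + s^2 b_i) / (x^2 + b_i),
    an odd rational function of degree 2k + 1 with R'(0) = s^(2k).  When the
    b_i are tiny, every factor is close to 1 at x = 1, so R 1 is close to 1,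
    and R 1 is the uniform norm as soon as R increases.  Letting s tend to 3
    then gives ratios R'(0) / R 1 arbitrarily close to 9^k.

    Monotonicity is read off the elasticity of R,
      x R'(x) / R(x) = 1 - sum_i loss(b_i, x^2),
    where loss(b, t) = 2 (s^2 - 1) b t / ((t + s^2 b) (t + b)) is a bump in t
    around the scale t = s b, with maximal value 2 (s - 1) / (s + 1).  That
    maximum is below 1 exactly because s < 3, which is where 9 = 3^2 comes
    from ([elasticity_loss_le_peak]).  The bump decays linearly as t tends to 0
    and like 1 / t at infinity, so bumps with widely separated scales hardly
    overlap and their sum stays below 1.  [separated_scales] chooses the scales
    one at a time, each one far below the preceding ones. *)

Set Implicit Arguments.
Unset Strict Implicit.
Unset Printing Implicit Defensive.

Import Order.TTheory GRing.Theory Num.Theory.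
Import numFieldNormedType.Exports.

Local Open Scope classical_set_scope.
Local Open Scope ring_scope.

(** * The rational functions and their derivatives *)

Definition factor (K : realType) (s b x : K) : K :=
  (x ^+ 2 + s ^+ 2 * b) / (x ^+ 2 + b).

Definition scale_product (K : realType) (s : K) (bs : seq K) (x : K) : K :=
  x * \prod_(b <- bs) factor s b x.

(** This is minus the elasticity x f'(x) / f(x) of f = factor s b, written as a
    function of t = x^2. *)
Definition elasticity_loss (K : realType) (s b t : K) : K :=
  2 * (s ^+ 2 - 1) * b * t / ((t + s ^+ 2 * b) * (t + b)).

Definition positive_seq (K : realType) (bs : seq K) := all (fun b => 0 < b) bs.

Lemma factor_gt0 (K : realType) (s b x : K) : 0 < b -> 0 < s ->
  0 < factor s b x.
Proof.
move=> b0 s0; have x20 := sqr_ge0 x.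
have sb0 : 0 < s ^+ 2 * b by rewrite mulr_gt0 ?exprn_gt0.
by apply: divr_gt0; lra.
Qed.

Lemma prod_factor_gt0 (K : realType) (s x : K) (bs : seq K) :
  0 < s -> positive_seq bs -> 0 < \prod_(b <- bs) factor s b x.
Proof.
move=> s0; elim: bs => [|b bs IH] /=; first by rewrite big_nil ltr01.
by move=> /andP[b0 bs0]; rewrite big_cons mulr_gt0 ?factor_gt0 ?IH.
Qed.

Lemma is_derive_factor (K : realType) (s b x : K) : 0 < b ->
  is_derive x (1 : K) (factor s b)
    (- (2 * (s ^+ 2 - 1) * b * x / (x ^+ 2 + b) ^+ 2)).
Proof.
move=> b0; have x20 := sqr_ge0 x.
have D0 : x ^+ 2 + b != 0 by apply: lt0r_neq0; lra.
have dsq (c : K) : is_derive x (1 : K) (fun y : K => y ^+ 2 + c) (2 * x).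
  have -> : (fun y : K => y ^+ 2 + c) = (@id K * @id K) + cst c.
    by apply/funext => y; rewrite expr2.
  apply: is_derive_eq; rewrite /GRing.scale /=; ring.
have dV := @is_deriveV K (fun y : K => y ^+ 2 + b) x (2 * x) 1 D0 (dsq b).
have -> : factor s b =
    (fun y => y ^+ 2 + s ^+ 2 * b) * (fun y => (y ^+ 2 + b)^-1).
  by [].
have dM := is_deriveM (dsq (s ^+ 2 * b)) dV.
by apply: is_derive_eq; rewrite /GRing.scale /=; field.
Qed.

(** Multiplying the elasticity formula by R x / x makes it valid at x = 0 too,
    so that one expression yields both R'(0) and the sign of R' on the whole
    line. *)
Lemma is_derive_scale_product (K : realType) (s x : K) (bs : seq K) :
  0 < s -> positive_seq bs ->
  is_derive x (1 : K) (scale_product s bs)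
    (\prod_(b <- bs) factor s b x *
     (1 - \sum_(b <- bs) elasticity_loss s b (x ^+ 2))).
Proof.
move=> s0; elim: bs => [_|b bs IH /= /andP[b0 bs0]].
  rewrite (_ : scale_product s [::] = id).
    by rewrite !big_nil subr0 mulr1; exact: is_derive_id.
  by apply/funext => y; rewrite /scale_product big_nil mulr1.
have -> : scale_product s (b :: bs) = factor s b * scale_product s bs.
  by apply/funext => y; rewrite /scale_product big_cons mulrCA.
have dM := is_deriveM (is_derive_factor s x b0) (IH bs0).
apply: is_derive_eq; rewrite /GRing.scale /= !big_cons /scale_product.
have x20 := sqr_ge0 x; have sb0 : 0 < s ^+ 2 * b by rewrite mulr_gt0 ?exprn_gt0.
rewrite /factor /elasticity_loss; field.
by apply/andP; split; apply: lt0r_neq0; lra.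
Qed.

Lemma rational_scale_product (K : realType) (s : K) (bs : seq K) :
  0 < s -> positive_seq bs ->
  rational_upto (2 * size bs).+1 (scale_product s bs).
Proof.
move=> s0 bs0; split.
  apply: derivable_within_continuous => x _.
  by have [] := is_derive_scale_product x s0 bs0.
have size_quad (c : K) : (size ('X^2 + c%:P)%R <= 3)%N.
  by rewrite size_polyDl ?size_polyXn // (leq_ltn_trans (size_polyC_leq1 _)).
have size_prod (f : K -> K) (cs : seq K) :
    (size (\prod_(b <- cs) ('X^2 + (f b)%:P))%R <= (2 * size cs).+1)%N.
  elim: cs => [|c cs IH]; first by rewrite big_nil size_poly1.
  rewrite big_cons (leq_trans (size_polyMleq _ _)) //=.
  rewrite mulnS -subn1 leq_subLR (_ : 1 + _ = 3 + (2 * size cs).+1)%N.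
    exact: leq_add (size_quad _) IH.
  by rewrite addnS.
have horner_den x : (\prod_(b <- bs) ('X^2 + b%:P)).[x] =
    \prod_(b <- bs) (x ^+ 2 + b).
  by rewrite horner_prod; apply: eq_bigr => b _; rewrite !hornerE.
exists ('X * \prod_(b <- bs) ('X^2 + (s ^+ 2 * b)%:P)),
       (\prod_(b <- bs) ('X^2 + b%:P)); split.
- rewrite /polys_upto /= (leq_trans (size_polyMleq _ _)) // size_polyX /=.
  exact: (size_prod (fun b => s ^+ 2 * b)).
- by rewrite /polys_upto /= ltnW // ltnS (size_prod id).
- apply: contraTneq (ltr01 : (0 : K) < 1) => /(congr1 (horner^~ 1)).
  rewrite horner_den horner0 => D0; suff: 0 < \prod_(b <- bs) (1 ^+ 2 + b : K).
    by rewrite D0 ltxx.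
  elim: (bs) bs0 {D0} => [|b cs IH] /=; first by rewrite big_nil ltr01.
  move=> /andP[b0 cs0]; rewrite big_cons mulr_gt0 ?IH // expr1n; lra.
- move=> x _ _; rewrite hornerM hornerX horner_den horner_prod /scale_product.
  rewrite -mulrA -prodf_div; congr (_ * _).
  by apply: eq_bigr => b _; rewrite !hornerE.
Qed.

Lemma odd_scale_product (K : realType) (s : K) (bs : seq K) :
  odd_on (scale_product s bs).
Proof.
move=> x _; rewrite /scale_product mulNr; congr (- (_ * _)).
by apply: eq_bigr => b _; rewrite /factor sqrrN.
Qed.

(** * Monotonicity, slope at the origin and norm *)

Lemma increasing_scale_product (K : realType) (s : K) (bs : seq K) :
  0 < s -> positive_seq bs ->
  (forall t, 0 <= t -> \sum_(b <- bs) elasticity_loss s b t < 1) ->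
  increasing_on (scale_product s bs).
Proof.
move=> s0 bs0 loss1; apply: gtr0_derive1_lt_cc.
- by move=> x _; have [] := is_derive_scale_product x s0 bs0.
- move=> x _; have [_ d] := is_derive_scale_product x s0 bs0.
  rewrite derive1E d mulr_gt0 ?prod_factor_gt0 // subr_gt0.
  by rewrite loss1 // sqr_ge0.
- apply: derivable_within_continuous => x _.
  by have [] := is_derive_scale_product x s0 bs0.
Qed.

Lemma derive1_scale_product0 (K : realType) (s : K) (bs : seq K) :
  0 < s -> positive_seq bs ->
  derive1 (scale_product s bs) 0 = (s ^+ 2) ^+ size bs.
Proof.
move=> s0 bs0; have [_] := is_derive_scale_product 0 s0 bs0.
rewrite derive1E => ->; rewrite expr0n /=.
rewrite [X in 1 - X]big1; last by move=> b _; rewrite /elasticity_loss mulr0 mul0r.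
rewrite subr0 mulr1; elim: (bs) bs0 => [|b cs IH] /=.
  by rewrite big_nil.
move=> /andP[b0 cs0]; rewrite big_cons IH // [RHS]exprS; congr (_ * _).
by rewrite /factor expr0n /= !add0r mulfK // lt0r_neq0.
Qed.

Lemma uniform_norm_odd_increasing (K : realType) (r : K -> K) :
  odd_on r -> increasing_on r -> uniform_norm r = r 1.
Proof.
move=> r_odd r_incr.
have one_in : (1 : K) \in `[-1, 1] by rewrite in_itv /=; lra.
have le_r1 x : x \in `[-1, 1] -> r x <= r 1.
  move=> xI; have := xI; rewrite in_itv /= => /andP[_].
  by rewrite le_eqVlt => /predU1P[->//|x1]; rewrite ltW // r_incr.
have abs_le x : x \in `[-1, 1] -> `|r x| <= r 1.
  move=> xI; rewrite ler_norml le_r1 // andbT lerNl -r_odd //.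
  by apply: le_r1; move: xI; rewrite !in_itv /=; lra.
have ub : ubound [set `|r x| | x in `[-1, 1]] (r 1).
  by move=> _ [x xI <-]; exact: abs_le.
apply/eqP; rewrite eq_le; apply/andP; split.
  by apply: ge_sup => //; exists `|r 1|; exists 1.
apply: le_trans (ler_norm _) _.
by apply: ub_le_sup; [exists (r 1) | exists 1].
Qed.

(** * Choice of the scales *)

(** The bound is the value at t = s b, where the arithmetic-geometric mean
    inequality (t + s^2 b) (t + b) >= (s + 1)^2 b t is an equality; the defect
    of that inequality is the square (t - s b)^2.  The form
    1 - (3 - s) / (s + 1) displays the positive margin that s < 3 leaves. *)
Lemma elasticity_loss_le_peak (K : realType) (s b t : K) :
  1 < s -> 0 < b -> 0 <= t ->
  elasticity_loss s b t <= 1 - (3 - s) / (s + 1).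
Proof.
move=> s1 b0 t0; have sb0 : 0 < s ^+ 2 * b by rewrite mulr_gt0 ?exprn_gt0 //; lra.
have -> : 1 - (3 - s) / (s + 1) = 2 * (s - 1) / (s + 1).
  by field; apply: lt0r_neq0; lra.
rewrite /elasticity_loss ler_pdivrMr; last by apply: mulr_gt0; lra.
rewrite [leRHS]mulrAC ler_pdivlMr; last lra.
rewrite -subr_ge0.
have -> : 2 * (s - 1) * ((t + s ^+ 2 * b) * (t + b)) -
    2 * (s ^+ 2 - 1) * b * t * (s + 1) = 2 * (s - 1) * (t - s * b) ^+ 2 by ring.
by rewrite mulr_ge0 ?sqr_ge0 //; lra.
Qed.

(** Far below its own scale a factor costs little: this leaves room for the
    full peak of a later factor placed there. *)
Lemma elasticity_loss_le_linear (K : realType) (s b t : K) :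
  1 < s -> 0 < b -> 0 <= t ->
  elasticity_loss s b t <= 2 * (s ^+ 2 - 1) / b * t.
Proof.
move=> s1 b0 t0; have s21 : 1 < s ^+ 2 by rewrite exprn_egt1.
have s2b : b <= s ^+ 2 * b by rewrite ler_peMl // ltW.
rewrite /elasticity_loss ler_pdivrMr; last by apply: mulr_gt0; lra.
have -> : 2 * (s ^+ 2 - 1) * b * t = 2 * (s ^+ 2 - 1) / b * t * (b * b).
  by field; rewrite lt0r_neq0.
apply: ler_wpM2l; last by apply: ler_pM; lra.
by rewrite mulr_ge0 // divr_ge0 //; lra.
Qed.

(** Far above its own scale a factor costs little: the bound tends to 0 with b
    uniformly in t >= eta, so a new factor with tiny b leaves the behaviour at
    the existing scales almost unchanged. *)
Lemma elasticity_loss_le_tail (K : realType) (s b t eta : K) :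
  1 < s -> 0 < b -> 0 < eta -> eta <= t ->
  elasticity_loss s b t <= 2 * (s ^+ 2 - 1) * b / eta.
Proof.
move=> s1 b0 eta0 etat; have s21 : 1 < s ^+ 2 by rewrite exprn_egt1.
have s2b : b <= s ^+ 2 * b by rewrite ler_peMl // ltW.
rewrite /elasticity_loss ler_pdivrMr; last by apply: mulr_gt0; lra.
have -> : 2 * (s ^+ 2 - 1) * b * t = 2 * (s ^+ 2 - 1) * b / eta * (t * eta).
  by field; rewrite lt0r_neq0.
apply: ler_wpM2l; last by apply: ler_pM; lra.
by rewrite divr_ge0 ?mulr_ge0 //; lra.
Qed.

(** Induction on k, adding a scale b below all the others.  The bound 1 - delta
    is what monotonicity requires; the linear bound C t makes the induction
    work.  With m the margin of the peak bound and eta = m / (2 C), for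
    t <= eta the old losses are at most m / 2 and the new one at most 1 - m,
    while for t > eta the old losses are at most 1 - delta and the new one is
    at most delta / 2 once b is small.  The product is controlled by comparing
    with r < s: each factor at 1 is at most s^2 / r^2 when b is small. *)
Lemma separated_scales (K : realType) (r s : K) (k : nat) :
  1 < r -> r < s -> s < 3 ->
  exists bs : seq K, [/\ size bs = k, positive_seq bs,
    r ^+ 2 ^+ k * \prod_(b <- bs) factor s b 1 <= s ^+ 2 ^+ k &
    exists delta C, [/\ 0 < delta, 0 < C & forall t, 0 <= t ->
      \sum_(b <- bs) elasticity_loss s b t <= Num.min (1 - delta) (C * t)]].
Proof.
move=> r1 rs s3; have s1 : 1 < s by lra.
have s21 : 1 < s ^+ 2 by rewrite exprn_egt1.
have r21 : 1 < r ^+ 2 by rewrite exprn_egt1.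
have rs2 : r ^+ 2 < s ^+ 2 by rewrite ltr_pXn2r // ?nnegrE; lra.
elim: k => [|k [bs [sz bs0 prod_le [delta [C [d0 C0 loss]]]]]].
  exists [::]; split=> //; first by rewrite big_nil mulr1.
  exists 1, 1; split=> // t t0; rewrite big_nil le_min subrr lexx mul1r.
  by rewrite t0.
set m := (3 - s) / (s + 1).
have m0 : 0 < m by apply: divr_gt0; lra.
set eta := m / (2 * C).
have eta0 : 0 < eta by apply: divr_gt0; lra.
(* b <= b1 gives the tail bound delta / 2 beyond eta; b <= b2 gives
   (1 + s^2 b) r^2 <= s^2, hence the bound on the factor at 1. *)
set b1 := delta * eta / (4 * (s ^+ 2 - 1)).
set b2 := (s ^+ 2 - r ^+ 2) / (s ^+ 2 * r ^+ 2).
set b := Num.min b1 b2.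
have b0 : 0 < b.
  rewrite lt_min; apply/andP; split; apply: divr_gt0; try lra.
    by rewrite mulr_gt0.
  by rewrite mulr_gt0 //; lra.
exists (b :: bs); split; first by rewrite /= sz.
- by rewrite /= b0.
- rewrite (exprS (r ^+ 2)) (exprS (s ^+ 2)) big_cons mulrACA; apply: ler_pM => //.
  + by rewrite mulr_ge0 ?ltW ?factor_gt0 ?exprn_gt0 //; lra.
  + by rewrite mulr_ge0 ?ltW ?prod_factor_gt0 ?exprn_gt0 //; lra.
  rewrite /factor expr1n mulrA ler_pdivrMr; last lra.
  have : b * (s ^+ 2 * r ^+ 2) <= s ^+ 2 - r ^+ 2.
    rewrite -ler_pdivlMr; last by rewrite mulr_gt0 //; lra.
    by rewrite ge_min lexx orbT.
  by have := mulr_ge0 (sqr_ge0 s) (ltW b0); lra.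
have tail : 2 * (s ^+ 2 - 1) * b / eta <= delta / 2.
  rewrite ler_pdivrMr //.
  have : b * (4 * (s ^+ 2 - 1)) <= delta * eta.
    by rewrite -ler_pdivlMr ?ge_min ?lexx //; lra.
  by lra.
exists (Num.min delta m / 2), (C + 2 * (s ^+ 2 - 1) / b); split.
- by rewrite divr_gt0 // lt_min d0.
- by rewrite addr_gt0 // divr_gt0 //; lra.
move=> t t0; rewrite big_cons le_min.
have [le_d le_C] := andP (etrans (esym (le_min _ _ _)) (loss _ t0)).
have lin := elasticity_loss_le_linear s1 b0 t0.
apply/andP; split; last by rewrite mulrDl addrC lerD.
have [md mm] : Num.min delta m <= delta /\ Num.min delta m <= m.
  by split; rewrite ge_min lexx ?orbT.
have [te|et] := leP t eta.
  have peak := elasticity_loss_le_peak s1 b0 t0.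
  have : C * t <= m / 2.
    have -> : m / 2 = C * eta by rewrite /eta; field; rewrite lt0r_neq0.
    by rewrite ler_pM2l.
  by rewrite -/m in peak; lra.
have := elasticity_loss_le_tail s1 b0 eta0 (ltW et).
by lra.
Qed.

Lemma pow9_approx (K : realType) (k : nat) (e : K) : 0 < e ->
  exists2 r : K, 1 < r < 3 & 9 ^+ k - e <= r ^+ 2 ^+ k.
Proof.
move=> e0; have pow_cvg : (x ^+ (2 * k) @[x --> (3 : K)^'-] --> (3 : K) ^+ (2 * k)).
  by apply: cvg_at_left_filter; exact: exprn_continuous.
have pow_lt : 9 ^+ k - e < (3 : K) ^+ (2 * k).
  rewrite exprM (_ : 3 ^+ 2 = 9); last by ring.
  by rewrite ltrBlDr ltrDl.
have near_gt : \forall x \near (3 : K)^'-, 9 ^+ k - e < x ^+ (2 * k).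
  exact: cvgr_gt pow_cvg _ pow_lt.
have near_13 : \forall x \near (3 : K)^'-, 1 < x < 3.
  by near=> x; apply/andP; split; near: x; [apply: nbhs_left_gt; lra | exact: nbhs_left_lt].
have [r [gt_r r13]] := filter_ex (filterI near_gt near_13).
by exists r => //; rewrite -exprM ltW.
Unshelve. all: by end_near. Qed.

Theorem theorem2 (K : realType) (n : nat) (hn : (1 <= n)%N) :
  (((9 ^+ (n - 1))%R)%:E <=
    ereal_sup [set ((derive1 r 0 / uniform_norm r)%R)%:E |
      r in [set r : K -> K | [/\ rational_upto (2 * n - 1)%N r,
                                 odd_on r & increasing_on r]]])%E.
Proof.
case: n hn => // k _; rewrite subn1 /=.
have -> : (2 * k.+1 - 1 = (2 * k).+1)%N by rewrite mulnS subn1.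
apply/lee_subgt0Pr => e e0.
have [r /andP[r1 r3] approx] := pow9_approx k e0.
have [] := @separated_scales K r ((r + 3) / 2) k r1; [lra|lra|].
set s := (r + 3) / 2 => bs [sz bs0 prod_le [delta [C [d0 C0 loss]]]].
have s0 : 0 < s by rewrite /s; lra.
have R_odd := @odd_scale_product K s bs.
have R_incr : increasing_on (scale_product s bs).
  apply: increasing_scale_product => // t t0.
  by have := loss t t0; rewrite le_min => /andP[? _]; lra.
apply: le_trans (ereal_sup_ubound _); last first.
  exists (scale_product s bs) => //; split => //.
  by rewrite -sz; exact: rational_scale_product.
rewrite -EFinB lee_fin (le_trans approx) // uniform_norm_odd_increasing //.
rewrite derive1_scale_product0 // sz /scale_product mul1r.
by rewrite ler_pdivlMr ?prod_factor_gt0.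
Qed.
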